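(* Let $X$ be a Boolean-topological algebra of type $\tau$ and let $B$ be its dual Boolean residuation algebra. Then $X$ is profinite if and only if $B$ is locally finite with respect to residuation ideals.
   Context: A Boolean-topological algebra of type $\tau$ is a compact Hausdorff space with a basis of clopen sets, equipped with an algebra structure of type $\tau$ whose basic operations are continuous. A topological algebra is profinite if it is (isomorphic to) the inverse limit, in the category of topological algebras of type $\tau$, of a directed inverse system of finite $\tau$-algebras (with discrete topology) and $\tau$-algebra morphisms. The Boolean residuation algebra $B$ dual to $X$ is the Boolean algebra of clopen subsets of $X$ with, for each $n$-ary basic operation $f$ and each $1\leq i\leq n$, the operation $$f_i^\sharp(U_1,\ldots,U_{i-1},U_{i+1},\ldots,U_n,V)=\{x\in X\mid \forall x_j\in U_j\ (j\neq i):\ f(x_1,\ldots,x_{i-1},x,x_{i+1},\ldots,x_n)\in V\}.$$ A Boolean residuation ideal of $B$ is a Boolean subalgebra $C$ of $B$ such that $f_i^\sharp(b_1,\ldots,b_{i-1},b_{i+1},\ldots,b_n,c)\in C$ for all $c\in C$, all $b_j\in B$, all $f\in\tau$ and all $i$. $B$ is locally finite with respect to residuation ideals if every finite subset of $B$ generates a finite Boolean residuation ideal, i.e. the smallest Boolean residuation ideal of $B$ containing it is finite. *)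

(* Defs.v *)
From HB Require Import structures.
From mathcomp Require Import all_boot all_order.
From mathcomp Require Import all_classical topology.
From mathcomp Require Import function_spaces separation_axioms.

Set Implicit Arguments.
Unset Strict Implicit.
Unset Printing Implicit Defensive.

Local Open Scope classical_set_scope.

Record signature := Signature {
  symbol : Type;
  arity : symbol -> nat }.

Definition operations (tau : signature) (A : Type) :=
  forall f : symbol tau, ('I_(arity f) -> A) -> A.

(* Carriers may be empty, here and for topological algebras. *)
Record finAlgebra (tau : signature) := FinAlgebra {
  fin_carrier :> finType;
  fin_op : operations tau fin_carrier }.
Arguments fin_op {tau} A f a : rename.

Record topAlgebra (tau : signature) := TopAlgebra {
  top_carrier :> topologicalType;
  top_op : operations tau top_carrier;
  top_op_continuous : forall f : symbol tau,
    continuous (@top_op f : {ptws 'I_(arity f) -> top_carrier} -> top_carrier) }.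
Arguments top_op {tau} X f a : rename.

Definition is_morphism (tau : signature) (A B : Type)
    (opA : operations tau A) (opB : operations tau B) (h : A -> B) :=
  forall (f : symbol tau) (a : 'I_(arity f) -> A),
    h (opA f a) = opB f (fun k => h (a k)).

Definition top_isomorphic (tau : signature) (X Y : topAlgebra tau) :=
  exists (h : X -> Y) (g : Y -> X),
    [/\ cancel h g, cancel g h,
        continuous h /\ continuous g &
        is_morphism (top_op X) (top_op Y) h /\
        is_morphism (top_op Y) (top_op X) g].

Record invSystem (tau : signature) := InvSystem {
  sys_index : Type;
  sys_le : sys_index -> sys_index -> Prop;
  sys_le_refl : forall i, sys_le i i;
  sys_le_trans : forall i j k, sys_le i j -> sys_le j k -> sys_le i k;
  sys_inhabited : inhabited sys_index;
  sys_directed : forall i j, exists k, sys_le i k /\ sys_le j k;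
  sys_obj : sys_index -> finAlgebra tau;
  sys_map : forall i j, sys_le i j -> sys_obj j -> sys_obj i;
  sys_map_morphism : forall i j (ij : sys_le i j),
    is_morphism (fin_op (sys_obj j)) (fin_op (sys_obj i)) (sys_map ij);
  sys_map_id : forall i (ii : sys_le i i) x, sys_map ii x = x;
  sys_map_comp : forall i j k (ij : sys_le i j) (jk : sys_le j k)
    (ik : sys_le i k) x, sys_map ij (sys_map jk x) = sys_map ik x }.

Section InverseLimit.
Variables (tau : signature) (S : invSystem tau).

Definition sys_prod : topologicalType :=
  prod_topology (fun i : sys_index S => discrete_topology (sys_obj i)).

Definition compatible : set sys_prod :=
  [set x | forall i j (ij : sys_le i j), sys_map ij (x j) = x i].

(* As a topological space, [set_type compatible] is the subspace of [sys_prod]. *)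
Lemma compatible_op (f : symbol tau) (a : 'I_(arity f) -> set_type compatible) :
  ((fun i => fin_op (sys_obj i) f (fun k => set_val (a k) i)) : sys_prod)
    \in compatible.
Proof.
apply/mem_set => i j ij; rewrite sys_map_morphism; congr (fin_op _ _).
by apply/funext => k; exact: (set_valP (a k)).
Qed.

Definition invlim_op : operations tau (set_type compatible) :=
  fun f a => SigSub (compatible_op a).

Lemma invlim_op_continuous (f : symbol tau) :
  continuous (@invlim_op f :
    {ptws 'I_(arity f) -> set_type compatible} -> set_type compatible).
Proof.
apply: continuous_comp_initial => /= a.
have aF := fmap_filter (set_val \o @invlim_op f)
  (nbhs_filter (a : {ptws 'I_(arity f) -> set_type compatible})).
apply/(cvg_sup _ _ aF) => i.
have near_eq (k : 'I_(arity f)) :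
    \forall b \near (a : {ptws 'I_(arity f) -> set_type compatible}),
      set_val (b k) i = set_val (a k) i.
  have cts : continuous ((fun b => set_val (b k) i) :
      {ptws 'I_(arity f) -> set_type compatible} ->
      discrete_topology (sys_obj i)).
    move=> b; apply: (@continuous_comp _ _ _
      (fun b : {ptws 'I_(arity f) -> set_type compatible} => b k)
      (fun x : set_type compatible => set_val x i)).
      exact: (@proj_continuous 'I_(arity f) (fun=> set_type compatible) k).
    apply: (@continuous_comp _ sys_prod _ set_val (fun x : sys_prod => x i)).
      exact: initial_continuous.
    exact: (@proj_continuous {classic (sys_index S)}
      (fun i => discrete_topology (sys_obj i)) i).
  exact: (cts a _ (discrete_set1 _)).
move=> A /= [B [[C _ <-] /= Ca] CA].
have := filter_forall (nbhs_filter _) near_eq.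
apply: filterS => b ab /=; apply: CA => /=.
rewrite [X in C X](_ : _ = fin_op (sys_obj i) f (fun k => set_val (a k) i)) //.
by congr (fin_op _ _); apply/funext.
Qed.

Definition invlim : topAlgebra tau := TopAlgebra invlim_op_continuous.

End InverseLimit.

Definition profinite (tau : signature) (X : topAlgebra tau) :=
  exists S : invSystem tau, top_isomorphic X (invlim S).

Definition boolean_topological (tau : signature) (X : topAlgebra tau) :=
  [/\ compact [set: X], hausdorff_space X &
      exists2 B : set (set X), B `<=` clopen & basis B].

Section Residuation.
Variables (tau : signature) (X : topAlgebra tau).

(* The n - 1 arguments U_j, j != i, are indexed by 'I_n.-1 through [lift i]. *)
Definition residual (f : symbol tau) (i : 'I_(arity f))
    (U : 'I_(arity f).-1 -> set X) (V : set X) : set X :=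
  [set x | forall a : 'I_(arity f) -> X,
    a i = x -> (forall j, U j (a (lift i j))) -> V (top_op X f a)].

(* The dual algebra of X has carrier [clopen : set (set X)], with the Boolean
   operations of [set X] and the operations [residual]. *)
Definition residuation_ideal (C : set (set X)) :=
  [/\ C `<=` clopen,
      [/\ C set0, C setT, (forall A, C A -> C (~` A)),
          setU_closed C & setI_closed C] &
      forall (f : symbol tau) (i : 'I_(arity f))
        (b : 'I_(arity f).-1 -> set X) (c : set X),
        (forall j, clopen (b j)) -> C c -> C (residual i b c)].

(* [clopen] is itself an ideal, so the generated ideal [smallest
   residuation_ideal S] is an intersection of a nonempty family. *)
Lemma clopen_residuation_ideal :
  boolean_topological X -> residuation_ideal clopen.
Proof.
move=> [Xcpt XH _]; split=> //.
  split; [exact: clopen0|exact: clopenT|by move=> A []; split;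
    [rewrite openC|rewrite closedC]|exact: clopenU|exact: clopenI].
move=> f i b c bclo cclo.
pose P := prod_topology (fun _ : 'I_(arity f) => top_carrier X).
pose K : set P :=
  [set a | (forall j, b j (a (lift i j))) /\ ~ c (top_op X f a)].
have Kclo : clopen K.
  have -> : K = (\bigcap_(j in [set` enum 'I_(arity f).-1])
      (fun a : P => a (lift i j)) @^-1` b j) `&` (top_op X f : P -> X) @^-1` (~` c).
    apply/seteqP; split=> a [ba ca]; split=> //; first by move=> j _; exact: ba.
    by move=> j; apply: (ba j); rewrite /= mem_enum.
  apply: clopenI; last first.
    apply: preimage_clopen; last exact: top_op_continuous.
    by case: cclo; split; [rewrite openC|rewrite closedC].
  rewrite bigcap_seq; apply: big_ind => [||j _].
  - exact: clopenT.
  - exact: clopenI.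
  - apply: preimage_clopen => //.
    exact: (@proj_continuous 'I_(arity f) (fun=> top_carrier X) (lift i j)).
have -> : residual i b c = ~` ((fun a : P => a i) @` K).
  apply/seteqP; split=> x /=.
    by move=> bcx [a [ba ca] ax]; apply/ca/bcx.
  move=> nK a ax ba; apply: contrapT => ca; apply: nK.
  by exists a.
split.
  rewrite openC; apply: compact_closed => //; apply: continuous_compact.
    apply: continuous_subspaceT.
    exact: (@proj_continuous 'I_(arity f) (fun=> top_carrier X) i).
  apply: (subclosed_compact (proj2 Kclo) _ (@subsetT _ _)).
  rewrite (_ : setT = [set a : P | forall k, [set: X] (a k)]).
    exact: (@tychonoff 'I_(arity f) (fun=> top_carrier X) (fun=> setT)).
  by apply/seteqP; split.
rewrite closedC.
exact: (@proj_open 'I_(arity f) (fun=> top_carrier X) i _ (proj1 Kclo)).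
Qed.

Definition loc_finite_residuation :=
  forall S : set (set X), S `<=` clopen -> finite_set S ->
    finite_set (smallest residuation_ideal S).

End Residuation.

(* Main.v *)
Require Import Defs.
From mathcomp Require Import all_boot finmap.
From mathcomp Require Import all_classical topology.

Set Implicit Arguments.
Unset Strict Implicit.
Unset Printing Implicit Defensive.

Local Open Scope classical_set_scope.

(** Call a map on [X] with finitely many values a finite quotient if it is
    locally constant and its kernel is a congruence.  Both sides of the
    equivalence say that the finite quotients separate the points of [X].

    If [X] is the limit of finite algebras, the limit projections form a
    directed separating family of such maps.  By compactness every clopen set
    is a union of fibers of a single projection, and by directedness this
    holds for finitely many clopen sets at once ([finite_clopen_saturated]).
    The sets that are unions of fibers of a fixed finite quotient form a
    finite residuation ideal ([saturated_residuation_ideal]), because a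
    residual [residual i b c] depends on its point only through the class of
    that point modulo a congruence saturating [c], whatever the parameters [b].

    Conversely, a residuation ideal [C] defines the relation of belonging to
    the same members of [C].  It is a congruence ([ideal_transfer]): when
    [f a] lies in [c], continuity yields clopen neighborhoods [b] of the
    arguments other than the [i]-th for which the residual of [c] contains the
    [i]-th argument; the residual is in [C], so that argument can be replaced
    by an equivalent one.  Local finiteness puts every clopen set in a finite
    ideal, and a finite ideal has finitely many, clopen classes, whence enough
    finite quotients to separate points.  They are directed under refinement,
    and compactness identifies [X] with the limit of the resulting system of
    finite algebras ([separated_profinite]). *)

(** * Saturated sets *)

Definition locally_constant (X : topologicalType) (T : Type) (p : X -> T) :=
  forall x, \forall y \near x, p y = p x.

Definition refines (X S T : Type) (q : X -> S) (p : X -> T) :=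
  forall x y, q x = q y -> p x = p y.

Definition saturated (X T : Type) (p : X -> T) (U : set X) :=
  forall x y, p x = p y -> U x -> U y.

Definition kernel_congruence (tau : signature) (A T : Type)
    (op : operations tau A) (p : A -> T) :=
  forall (f : symbol tau) (a b : 'I_(arity f) -> A),
    (forall k, p (a k) = p (b k)) -> p (op f a) = p (op f b).

Lemma saturated_open (X : topologicalType) (T : Type) (p : X -> T) (U : set X) :
  locally_constant p -> saturated p U -> open U.
Proof.
move=> lcp satU; rewrite openE => x Ux; apply: filterS (lcp x) => y yx.
exact: (satU x y).
Qed.

Lemma saturatedC (X T : Type) (p : X -> T) (U : set X) :
  saturated p U -> saturated p (~` U).
Proof. by move=> satU x y xy nUx Uy; apply: nUx; exact: (satU y x). Qed.

Lemma saturated_clopen (X : topologicalType) (T : Type) (p : X -> T)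
    (U : set X) :
  locally_constant p -> saturated p U -> clopen U.
Proof.
move=> lcp satU; split; first exact: saturated_open satU.
by rewrite -openC; apply: saturated_open (saturatedC satU).
Qed.

Lemma finite_saturated (X : Type) (T : finType) (p : X -> T) :
  finite_set [set U | saturated p U].
Proof.
apply: (@sub_finite_set _ _
  ((fun A : {set T} => p @^-1` [set` A]) @` [set: {set T}])); last first.
  by apply: finite_image; exact: finite_finset.
move=> U satU; exists [set t | `[< exists2 x, U x & p x = t >]]%SET => //.
apply/seteqP; split=> [x /=|x Ux].
  by rewrite inE => /asboolP [y Uy yx]; exact: (satU y x).
by rewrite /= inE; apply/asboolP; exists x.
Qed.

(** * Directed families of locally constant maps on a compact space *)

(** If no [O i] contained [K], the sets [K `\` O i] would be a filter base on
    the compact set [K], and a cluster point of it could lie in no [O i]. *)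
Lemma compact_directed_cover (X : topologicalType) (I : Type) (K : set X)
    (O : I -> set X) :
  compact K -> inhabited I -> (forall i, open (O i)) ->
  (forall i j, exists k, O i `<=` O k /\ O j `<=` O k) ->
  K `<=` \bigcup_i O i -> exists i, K `<=` O i.
Proof.
move=> cptK [i0] oO dirO KO; apply: contrapT => nKO.
pose F := filter_from setT (fun i => K `\` O i).
have FF : ProperFilter F.
  apply: filter_from_proper.
    apply: filter_from_filter; first by exists i0.
    move=> i j _ _; have [k [ik jk]] := dirO i j; exists k => // x [Kx nOx].
    by split; split=> // Ox; apply: nOx; [exact: ik|exact: jk].
  move=> i _; apply: contrapT => nex; apply: nKO; exists i => x Kx.
  by apply: contrapT => nOx; apply: nex; exists x.
have FK : F K by exists i0 => // x [].
have [x [Kx clx]] := cptK F FF FK; have [i _ Oix] := KO x Kx.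
have Fi : F (K `\` O i) by exists i.
have [y [[_ nOy] Oy]] := clx _ _ Fi (open_nbhs_nbhs (conj (oO i) Oix)).
exact: nOy.
Qed.

Section DirectedFamily.
Variables (X : topologicalType) (I : Type) (T : I -> Type).
Variable p : forall i, X -> T i.
Hypothesis cptX : compact [set: X].
Hypothesis inhI : inhabited I.
Hypothesis lc_p : forall i, locally_constant (p i).
Hypothesis dir_p : forall i j, exists k,
  refines (p k) (p i) /\ refines (p k) (p j).
Hypothesis sep_p : forall x y, (forall i, p i x = p i y) -> x = y.

(** The sets of points that [p i] separates from [x] are open, directed, and
    cover the complement of [U], which is compact. *)
Lemma fiber_sub_open (x : X) (U : set X) :
  open U -> U x -> exists i, forall y, p i y = p i x -> U y.
Proof.
move=> oU Ux.
have cptU : compact (~` U).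
  by apply: (subclosed_compact _ cptX) => //; rewrite closedC.
have [|i j|y nUy|i Ui] :=
  @compact_directed_cover X I _ (fun i => [set y | p i y <> p i x]) cptU inhI.
- move=> i; apply: (saturated_open (lc_p i)) => y z yz /=.
  by rewrite yz.
- have [k [ki kj]] := dir_p i j; exists k.
  by split=> y /= nyx yx; apply: nyx; [exact: ki|exact: kj].
- apply: contrapT => nyx; apply: nUy; suff -> : y = x by [].
  by apply: sep_p => i; apply: contrapT => nyxi; apply: nyx; exists i.
- by exists i => y yx; apply: contrapT => nUy; exact: (Ui y nUy).
Qed.

(** The largest [p i]-saturated subsets of [U] are open and directed, and they
    cover [U] by [fiber_sub_open]; so one of them is [U]. *)
Lemma clopen_saturated (U : set X) : clopen U -> exists i, saturated (p i) U.
Proof.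
move=> [oU cU].
have cptU : compact U by apply: (subclosed_compact cU cptX).
have [|i j|x Ux|i Ui] := @compact_directed_cover X I _
  (fun i => [set x | forall y, p i y = p i x -> U y]) cptU inhI.
- move=> i; apply: (saturated_open (lc_p i)) => x y xy /= xU z zy.
  by apply: xU; rewrite zy.
- have [k [ki kj]] := dir_p i j; exists k.
  by split=> x /= xU y yx; apply: xU; [exact: ki|exact: kj].
- by have [i xi] := fiber_sub_open oU Ux; exists i.
- by exists i => x y xy Ux; apply: (Ui x Ux); rewrite xy.
Qed.

Lemma finite_clopen_saturated (S : set (set X)) :
  S `<=` clopen -> finite_set S -> exists i, S `<=` saturated (p i).
Proof.
move=> Sclo /finite_seqP [s Ss]; rewrite {}Ss in Sclo *.
elim: s Sclo => [|U s IHs] Sclo; first by have [i] := inhI; exists i.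
have [i si] := IHs (fun V sV => Sclo V (mem_behead (s := U :: s) sV)).
have [j Uj] := clopen_saturated (Sclo U (mem_head U s)).
have [k [ki kj]] := dir_p i j; exists k => V /=.
rewrite inE => /orP [/eqP ->|sV] x y xy; first exact/Uj/kj.
exact/(si V sV)/ki.
Qed.

(** Were the intersection of the fibers empty, their complements would be a
    directed open cover of [X], so a single fiber would be empty.  The
    hypothesis expresses that [t] is compatible with the comparison maps
    between the images of the [p i], without naming these maps. *)
Lemma fibers_meet (t : forall i, T i) :
  (forall i k, refines (p k) (p i) -> exists x, p k x = t k /\ p i x = t i) ->
  exists x, forall i, p i x = t i.
Proof.
move=> tP.
have t_fiber i k : refines (p k) (p i) -> forall y, p k y = t k -> p i y = t i.
  by move=> ki y yk; have [x [xk <-]] := tP i k ki; apply: ki; rewrite xk.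
apply: contrapT => nex.
have [|i j|x _|i Xi] := @compact_directed_cover X I _
  (fun i => [set x | p i x <> t i]) cptX inhI.
- move=> i; apply: (saturated_open (lc_p i)) => x y xy /=.
  by rewrite xy.
- have [k [ki kj]] := dir_p i j; exists k.
  by split=> y /= ny yk; apply: ny; [exact: (t_fiber i k)|exact: (t_fiber j k)].
- apply: contrapT => nx; apply: nex; exists x => i.
  by apply: contrapT => nxi; apply: nx; exists i.
- by have [x [xi _]] := tP i i (fun _ _ => id); exact: (Xi x).
Qed.

End DirectedFamily.

(** * Residuation ideals and congruences *)

Section Ideals.
Variables (tau : signature) (X : topAlgebra tau).

(** Moving the [i]-th argument inside its class moves the value of the
    operation inside its class, for any choice of the other arguments; this
    is why arbitrary sets [b] are harmless. *)
Lemma residual_saturated (T : Type) (p : X -> T) (f : symbol tau)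
    (i : 'I_(arity f)) (b : 'I_(arity f).-1 -> set X) (c : set X) :
  kernel_congruence (top_op X) p -> saturated p c ->
  saturated p (residual i b c).
Proof.
move=> congp satc x y xy xbc a ay ba.
pose a' k := if k == i then x else a k.
apply: (satc (top_op X f a')).
  by apply: congp => k; rewrite /a'; case: eqP => // ->; rewrite ay.
apply: xbc => [|j]; first by rewrite /a' eqxx.
by rewrite /a' eq_sym (negPf (neq_lift i j)); exact: ba.
Qed.

Lemma saturated_residuation_ideal (T : Type) (p : X -> T) :
  locally_constant p -> kernel_congruence (top_op X) p ->
  residuation_ideal (saturated p : set (set X)).
Proof.
move=> lcp congp; split.
- by move=> U; exact: saturated_clopen.
- split=> //; first by move=> U; exact: saturatedC.
  + by move=> U V satU satV x y xy [/(satU _ _ xy)|/(satV _ _ xy)];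
    [left|right].
  + by move=> U V satU satV x y xy [/(satU _ _ xy) ? /(satV _ _ xy)].
- by move=> f i b c _; exact: residual_saturated.
Qed.

(** The hypotheses make the clopen sets one of the ideals containing [S]; an
    intersection over no ideal would contain sets that are not clopen. *)
Lemma smallest_residuation_ideal (S : set (set X)) :
  boolean_topological X -> S `<=` clopen ->
  residuation_ideal (smallest (@residuation_ideal tau X) S).
Proof.
move=> BX Sclo; split.
- by apply: smallest_sub => //; exact: clopen_residuation_ideal.
- split.
  + by move=> C [[_ []]].
  + by move=> C [[_ []]].
  + move=> A SA C CC; have [[_ [_ _ HC _ _] _] SC] := CC.
    by apply: HC; exact: SA.
  + move=> A B SA SB C CC; have [[_ [_ _ _ HC _] _] SC] := CC.
    by apply: HC; [exact: SA|exact: SB].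
  + move=> A B SA SB C CC; have [[_ [_ _ _ _ HC] _] SC] := CC.
    by apply: HC; [exact: SA|exact: SB].
- move=> f i b c bclo Sc C CC; have [[_ _ HC] SC] := CC.
  by apply: HC => //; exact: Sc.
Qed.

(** The clopen boxes around [a] form a filter base that converges to [a] in
    each coordinate, hence in the product; the continuous operation [f] maps
    this filter to one containing [c]. *)
Lemma clopen_box (f : symbol tau) (a : 'I_(arity f) -> X) (c : set X) :
  boolean_topological X -> clopen c -> c (top_op X f a) ->
  exists b : 'I_(arity f) -> set X,
    [/\ forall k, clopen (b k), forall k, b k (a k) &
        forall a', (forall k, b k (a' k)) -> c (top_op X f a')].
Proof.
move=> [_ _ [B Bclo [_ basisB]]] [oc _] ca.
pose F : set_system {ptws 'I_(arity f) -> X} :=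
  filter_from [set b : 'I_(arity f) -> set X |
      forall k, clopen (b k) /\ b k (a k)]
    (fun b => [set a' | forall k, b k (a' k)]).
have FF : Filter F.
  apply: filter_from_filter.
    by exists (fun=> setT) => k; split=> //; exact: clopenT.
  move=> b b' Hb Hb'; exists (fun k => b k `&` b' k).
    move=> k; have [? ?] := Hb k; have [? ?] := Hb' k.
    by split=> //; exact: clopenI.
  by move=> a' ba'; split=> k; have [] := ba' k.
have Fa : F --> (a : {ptws 'I_(arity f) -> X}).
  apply/(cvg_sup _ _ FF) => k V /= [W [[W' oW' <-] /= W'a] WV].
  have [U [BU Ua] UW] := basisB (a k) W' (open_nbhs_nbhs (conj oW' W'a)).
  exists (fun j => if j == k then U else setT) => /=.
    move=> j; case: eqP => [->|_]; last by split=> //; exact: clopenT.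
    by split=> //; exact: Bclo.
  by move=> a' /(_ k); rewrite eqxx => Ua'; apply: WV; exact: UW.
have [b Hb bc] : F (top_op X f @^-1` c).
  apply: Fa; apply: (@top_op_continuous tau X f).
  exact: (open_nbhs_nbhs (conj oc ca)).
by exists b; split=> [k|k|//]; have [] := Hb k.
Qed.

(** For a box [b] around [a] mapped into [c], the residual of [c] with respect
    to the sides of [b] other than the [i]-th contains [a i].  As a member of
    the ideal it contains [a' i] too, which is what [c (f a')] requires. *)
Lemma ideal_transfer1 (C : set (set X)) (c : set X) (f : symbol tau)
    (i : 'I_(arity f)) (a a' : 'I_(arity f) -> X) :
  boolean_topological X -> residuation_ideal C -> C c ->
  (forall U, C U -> U (a i) -> U (a' i)) ->
  (forall k, k != i -> a' k = a k) ->
  c (top_op X f a) -> c (top_op X f a').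
Proof.
move=> BX [Cclo _ Cres] Cc aa' eqaa' ca.
have [b [bclo ba bc]] := clopen_box BX (Cclo _ Cc) ca.
pose b' j := b (lift i j).
have /aa' : C (residual i b' c) by apply: Cres => // j; exact: bclo.
apply=> //.
  move=> a'' a''i ba''; apply: bc => k.
  by case: (unliftP i k) => [j ->|->]; [exact: ba''|rewrite a''i].
by move=> j; rewrite /b' eqaa' // eq_sym; exact: neq_lift.
Qed.

(** The arguments are replaced one at a time, from the first to the last. *)
Lemma ideal_transfer (C : set (set X)) (c : set X) (f : symbol tau)
    (a a' : 'I_(arity f) -> X) :
  boolean_topological X -> residuation_ideal C -> C c ->
  (forall k U, C U -> U (a k) -> U (a' k)) ->
  c (top_op X f a) -> c (top_op X f a').
Proof.
move=> BX idC Cc aa' ca.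
pose hyb m (k : 'I_(arity f)) := if k < m then a' k else a k.
have hybP m : m <= arity f -> c (top_op X f (hyb m)).
  elim: m => [_|m IHm lt_m].
    by rewrite (_ : hyb 0 = a) //; apply/funext.
  apply: (@ideal_transfer1 C c f (Ordinal lt_m) (hyb m)) => //.
  - by move=> U CU; rewrite /hyb /= ltnn ltnSn; exact: aa'.
  - move=> k; rewrite -val_eqE /= => neq_km.
    by rewrite /hyb ltnS leq_eqVlt (negPf neq_km).
  - by apply: IHm; exact: ltnW.
rewrite (_ : a' = hyb (arity f)); first exact: hybP.
by apply/funext => k; rewrite /hyb ltn_ord.
Qed.

(** A point is sent to the indicator function of the members of [C] that
    contain it, so equality of values is membership in the same members. *)
Lemma finite_ideal_kernel (C : set (set X)) :
  boolean_topological X -> residuation_ideal C -> finite_set C ->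
  exists (T : finType) (p : X -> T),
    [/\ locally_constant p, kernel_congruence (top_op X) p &
        C `<=` saturated p].
Proof.
move=> BX idC finC; have [Cclo [_ _ CC _ _] _] := idC.
pose I := fset_set C.
have CI (U : I) : C (val U).
  by have := valP U; rewrite in_fset_set // inE.
exists {ffun I -> bool}, (fun x => [ffun U : I => `[< val U x >]]); split.
- move=> x.
  have : forall U : I, \forall y \near x, `[< val U y >] = `[< val U x >].
    move=> U; have [oU _] := Cclo _ (CI U).
    have [onU _] := Cclo _ (CC _ (CI U)).
    case: (pselect (val U x)) => Ux.
      have := open_nbhs_nbhs (conj oU Ux); apply: filterS => y Uy.
      by rewrite !asboolT.
    have := open_nbhs_nbhs (conj onU Ux); apply: filterS => y Uy.
    by rewrite !asboolF.
  move/filter_forall; apply: filterS => y yx.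
  by apply/ffunP => U; rewrite !ffunE.
- move=> f a b ab; apply/ffunP => U; rewrite !ffunE.
  suff tr a' b' : (forall k, [ffun V : I => `[< val V (a' k) >]] =
      [ffun V : I => `[< val V (b' k) >]]) ->
      val U (top_op X f a') -> val U (top_op X f b').
    by apply/asbool_equiv_eq; split; apply: tr.
  move=> ab'; apply: (ideal_transfer BX idC (CI U)) => k V CV.
  have VI : V \in I by rewrite in_fset_set // inE.
  have /ffunP/(_ [` VI]%fset) := ab' k.
  by rewrite !ffunE /= => e /(asbool_eq_equiv e).
- move=> U CU x y.
  have UI : U \in I by rewrite in_fset_set // inE.
  by move=> /ffunP/(_ [` UI]%fset); rewrite !ffunE /= => e /(asbool_eq_equiv e).
Qed.

End Ideals.

(** * The inverse system of finite quotients *)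

Section Quotients.
Variables (tau : signature) (X : topAlgebra tau).

(** Values in an ordinal, rather than quantification over all finite types,
    keep the collection small enough to index an inverse system. *)
Record fin_quotient := FinQuotient {
  fq_size : nat;
  fq_map :> X -> 'I_fq_size;
  fq_locally_constant : locally_constant fq_map;
  fq_congruence : kernel_congruence (top_op X) fq_map }.

Lemma fin_quotient_of (T : finType) (p : X -> T) :
  locally_constant p -> kernel_congruence (top_op X) p ->
  exists q : fin_quotient, forall x y, q x = q y <-> p x = p y.
Proof.
move=> lcp congp.
have lcq : locally_constant (fun x => enum_rank (p x)).
  by move=> x; apply: filterS (lcp x) => y ->.
have congq : kernel_congruence (top_op X) (fun x => enum_rank (p x)).
  by move=> f a b ab; congr enum_rank; apply: congp => k; exact: enum_rank_inj.
by exists (FinQuotient lcq congq) => x y; split=> [/enum_rank_inj|/= ->].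
Qed.

Implicit Types p q r : fin_quotient.

(** The map [q] need not be onto; its image is the carrier of the quotient. *)
Definition class_type q : finType :=
  {k : 'I_(fq_size q) | `[< exists x, q x = k >]}.

Definition class q (x : X) : class_type q :=
  exist _ (q x) (asboolT (ex_intro _ x erefl)).

Definition repr q (k : class_type q) : X := sval (cid (asboolW (valP k))).

Lemma reprK q : cancel (@repr q) (class q).
Proof. by move=> k; apply: val_inj; rewrite /= /repr; case: cid. Qed.

Lemma map_repr q (x : X) : q (repr (class q x)) = q x.
Proof. exact: (congr1 val (reprK (class q x))). Qed.

Lemma class_eq q (x y : X) : q x = q y -> class q x = class q y.
Proof. by move=> xy; exact: val_inj. Qed.

Definition quotient_algebra q : finAlgebra tau :=
  FinAlgebra (fun f (a : 'I_(arity f) -> class_type q) =>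
    class q (top_op X f (fun k => repr (a k)))).

Lemma class_morphism q :
  is_morphism (top_op X) (fin_op (quotient_algebra q)) (class q).
Proof.
by move=> f a; apply: class_eq; apply: fq_congruence => k; rewrite map_repr.
Qed.

(** The refinement is kept as an argument to match the shape of the
    transition maps of an inverse system; it makes the map a morphism. *)
Definition quotient_map p q (_ : refines q p) (k : class_type q) :
  class_type p := class p (repr k).

Lemma quotient_map_class p q (qp : refines q p) (x : X) :
  quotient_map qp (class q x) = class p x.
Proof. by apply: class_eq; apply: qp; rewrite map_repr. Qed.

Lemma quotient_map_morphism p q (qp : refines q p) :
  is_morphism (fin_op (quotient_algebra q)) (fin_op (quotient_algebra p))
    (quotient_map qp).
Proof. by move=> f a; rewrite /= quotient_map_class class_morphism. Qed.

Lemma quotient_map_id q (qq : refines q q) k : quotient_map qq k = k.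
Proof. exact: reprK. Qed.

Lemma quotient_map_comp p q r (qp : refines q p) (rq : refines r q)
    (rp : refines r p) k :
  quotient_map qp (quotient_map rq k) = quotient_map rp k.
Proof. exact: quotient_map_class. Qed.

Lemma fin_quotient_inhabited : inhabited fin_quotient.
Proof.
have [x|//|q _] := @fin_quotient_of unit (fun=> tt); last by exists.
exact: nearW.
Qed.

Lemma fin_quotient_directed p q : exists r, refines r p /\ refines r q.
Proof.
have [||r rP] := @fin_quotient_of _ (fun x => (p x, q x)).
- move=> x.
  by apply: filterS2 (fq_locally_constant p x) (fq_locally_constant q x)
    => y -> ->.
- move=> f a b ab; congr pair; apply: fq_congruence => k;
  by have [] := ab k.
- by exists r; split=> x y /rP [].
Qed.

Definition quotient_system : invSystem tau :=
  @InvSystem tau fin_quotient (fun p q => refines q p)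
    (fun _ _ _ => id) (fun p q r qp rq x y xy => qp x y (rq x y xy))
    fin_quotient_inhabited fin_quotient_directed
    quotient_algebra quotient_map quotient_map_morphism
    quotient_map_id quotient_map_comp.

End Quotients.

(** * Profinite algebras *)

Section Profinite.
Variables (tau : signature) (X : topAlgebra tau).

Lemma limit_projection_locally_constant (S : invSystem tau) (i : sys_index S) :
  locally_constant (fun z : invlim S => set_val z i).
Proof.
have cts : continuous ((fun z => set_val z i) :
    set_type (@compatible tau S) -> discrete_topology (sys_obj i)).
  move=> z; apply: (@continuous_comp _ (sys_prod S) _ set_val
    (fun x : sys_prod S => x i)); first exact: initial_continuous.
  exact: (@proj_continuous {classic (sys_index S)}
    (fun i => discrete_topology (sys_obj i)) i).
by move=> z; exact: (cts z _ (discrete_set1 _)).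
Qed.

(** The sets saturated for one limit projection form a finite ideal, and some
    projection saturates all the given clopen sets. *)
Lemma profinite_loc_finite :
  compact [set: X] -> profinite X -> loc_finite_residuation X.
Proof.
move=> cptX [S [h [g [hK _ [cth _] [morh _]]]]] A Aclo finA.
pose p i (x : X) : sys_obj i := set_val (h x) i.
have lcp i : locally_constant (p i).
  by move=> x; exact: (cth x _ (@limit_projection_locally_constant S i (h x))).
have ref_p i j : sys_le i j -> refines (p j) (p i).
  move=> ij x y xy.
  have pij u : sys_map ij (p j u) = p i u := set_valP (h u) i j ij.
  by rewrite -!pij xy.
have dirp i j : exists k, refines (p k) (p i) /\ refines (p k) (p j).
  by have [k [ik jk]] := sys_directed i j; exists k; split; exact: ref_p.
have sepp x y : (forall i, p i x = p i y) -> x = y.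
  move=> xy; apply: (can_inj hK); apply: val_inj.
  by apply: functional_extensionality_dep.
have [i iA] :=
  finite_clopen_saturated cptX (sys_inhabited S) lcp dirp sepp Aclo finA.
have congp : kernel_congruence (top_op X) (p i).
  move=> f a b ab; rewrite /p !morh /=; congr fin_op.
  exact/funext.
apply: sub_finite_set (finite_saturated (p i)).
exact: (smallest_sub (saturated_residuation_ideal (lcp i) congp)).
Qed.

(** Two points that the finite quotients identify lie in the same clopen sets:
    each clopen [W] is saturated for the kernel of the finite ideal that it
    generates.  In a Hausdorff space with a clopen base they are then equal. *)
Lemma loc_finite_separated (x y : X) :
  boolean_topological X -> loc_finite_residuation X ->
  (forall q : fin_quotient X, q x = q y) -> x = y.
Proof.
move=> BX lfX xy; have [_ HX [B Bclo [_ basisB]]] := BX.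
apply: HX => U V Ux Vy; exists y; split; last exact: nbhs_singleton.
have [W [BW Wx] WU] := basisB x U Ux; apply: WU.
have Sclo : [set W] `<=` clopen by move=> _ ->; exact: Bclo.
have [T [p [lcp congp sat]]] := finite_ideal_kernel BX
  (smallest_residuation_ideal BX Sclo) (lfX _ Sclo (finite_set1 W)).
have [q qP] := fin_quotient_of lcp congp.
by apply: (sat W _ x y) => //; [exact: sub_gen_smallest|exact/qP/xy].
Qed.

(** The canonical map [h] to the limit is onto by [fibers_meet].  Its inverse
    is continuous because a neighborhood of [x] contains a fiber of a finite
    quotient ([fiber_sub_open]), whose image is a cylinder of the limit. *)
Lemma separated_profinite :
  compact [set: X] ->
  (forall x y, (forall q : fin_quotient X, q x = q y) -> x = y) ->
  profinite X.
Proof.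
move=> cptX sepX; pose S := quotient_system X; exists S.
have lcX (q : fin_quotient X) : locally_constant q.
  exact: fq_locally_constant.
have compX (x : X) : ((fun q => class q x) : sys_prod S) \in @compatible tau S.
  by apply/mem_set => p q qp; exact: quotient_map_class.
pose h (x : X) : invlim S := SigSub (compX x).
have h_inj : injective h.
  move=> x y xy; apply: sepX => q.
  exact: (congr1 (fun z : invlim S => val (set_val z q : class_type q)) xy).
have h_surj (z : invlim S) : exists x, h x = z.
  have [x xz] : exists x, forall q : fin_quotient X,
      q x = val (set_val z q : class_type q).
    apply: (fibers_meet cptX (@fin_quotient_inhabited _ X) lcX
      (@fin_quotient_directed _ X)) => p q qp.
    exists (repr (set_val z q)); split; first exact: (congr1 val (reprK _)).
    exact: (congr1 val (set_valP z p q qp)).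
  exists x; apply: val_inj; apply: functional_extensionality_dep => q.
  by apply: val_inj; exact: xz.
pose g (z : invlim S) : X := sval (cid (h_surj z)).
have gK : cancel g h by move=> z; rewrite /g; case: cid.
have hK : cancel h g by move=> x; apply: h_inj; rewrite gK.
have morh : is_morphism (top_op X) (top_op (invlim S)) h.
  move=> f a; apply: val_inj; apply: functional_extensionality_dep => q.
  exact: class_morphism.
exists h, g; split=> //; split=> //.
- apply: continuous_comp_initial => /= x.
  have hF := fmap_filter (set_val \o h) (nbhs_filter x).
  apply/(cvg_sup _ _ hF) => q A /= [B [[C _ <-] /= Cx] CA].
  have := lcX q x; apply: filterS => y yx /=; apply: CA => /=.
  by have -> : set_val (h y) q = set_val (h x) q by exact: class_eq yx.
- move=> z U; rewrite nbhsE => -[V [oV Vz] VU].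
  have [q qV] := fiber_sub_open cptX (@fin_quotient_inhabited _ X) lcX
    (@fin_quotient_directed _ X) sepX oV Vz.
  have := @limit_projection_locally_constant S q z.
  apply: filterS => w wz; apply: VU; apply: qV.
  have class_g u : set_val u q = class q (g u) by rewrite -{1}[u]gK.
  move: wz; rewrite !class_g => wz. exact: (congr1 val wz).
- move=> f a; apply: h_inj; rewrite morh gK; congr (top_op (invlim S) f _).
  by apply/funext => k; rewrite gK.
Qed.

End Profinite.

Theorem theorem4p2 (tau : signature) (X : topAlgebra tau) :
  boolean_topological X -> (profinite X <-> loc_finite_residuation X).
Proof.
move=> BX; have [cptX _ _] := BX; split; first exact: profinite_loc_finite.
move=> lfX; apply: separated_profinite => // x y.
exact: loc_finite_separated.
Qed.
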